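(* There is an absolute constant $c>0$ (possibly different for the fixed and the trainable classes below) such that the following holds. Let $\mathcal{F}_{\mathrm{RatNN}}$, $\mathcal{F}^T_{\mathrm{RatNN}}$, $\mathcal{F}_{\mathrm{RatCNN}}$, $\mathcal{F}^T_{\mathrm{RatCNN}}$ be the hypothesis classes of depth-$L$ rational fully connected, respectively convolutional, networks with fixed (no superscript), respectively trainable (superscript $T$), activations of type $R^s_s$, as defined in the context. Denote by $N$ the number of parameters in the network, and suppose $\operatorname{im}(\rho_L)\subseteq[-t,t]$. Then for $\mathcal{F}=\mathcal{F}_{\mathrm{RatNN}}$ or $\mathcal{F}^T_{\mathrm{RatNN}}$ and any $\varepsilon\in(0,\operatorname{diam}(\mathcal{F}(X))]$, $$\sup_{X\in\mathbb{R}^{d_0\times n}}\log\mathcal{N}(\mathcal{F}(X),\varepsilon)\;\leq\; N\log(t/\varepsilon)+(N+1)\log\Big(c\,N(nd_L)^{5/2}s^L\prod_{j=1}^{L-1}d_j\Big).$$ For $\mathcal{F}=\mathcal{F}_{\mathrm{RatCNN}}$ or $\mathcal{F}^T_{\mathrm{RatCNN}}$ and any $\varepsilon\in(0,\operatorname{diam}(\mathcal{F}(X))]$, $$\sup_{X\in\mathbb{R}^{d_0\times n}}\log\mathcal{N}(\mathcal{F}(X),\varepsilon)\;\leq\; N\log(t/\varepsilon)+(N+1)\log\Big(c\,N(nd_L)^{5/2}s^Lk^{2(L-1)}\prod_{j=1}^{L-1}c_j\Big).$$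
   Context: Rational functions: $R^a_b$ is the set of functions $\rho=p/q$ with $p,q$ real polynomials, $\deg p\le a$, $\deg q\le b$, defined on an open dense subset; a vector-valued map is in $R^a_b$ if all its coordinate functions are. Univariate activations are applied entrywise. Rational fully connected networks: $f(x)=\rho_L\big[A_L(\cdots\rho_1(A_1x+b_1)\cdots)+b_L\big]$ from $\mathbb{R}^{d_0}$ to $\mathbb{R}^{d_L}$, with $\rho_i\in R^s_s$, weight matrices $A_i\in\mathbb{R}^{d_i\times d_{i-1}}$, biases $b_i\in\mathbb{R}^{d_i}$, $i=1,\dots,L$. Rational convolutional networks: the same with $A_i x$ replaced by $\mathcal{K}_i x$, where $\mathcal{K}_i\in\mathbb{R}^{c_i\times c_{i-1}\times k\times k}$ is a convolution kernel mapping $\mathbb{R}^{d_{i-1}}$ to $\mathbb{R}^{d_i}$ ($d_i$ is the total size of the ''image'' with $c_i$ channels; strides and zero or constant padding allowed). Classes: in $\mathcal{F}_{\mathrm{RatNN}}$, $\mathcal{F}_{\mathrm{RatCNN}}$ the activations $\rho_i\in R^s_s$ are fixed and the parameters are the entries of $A_i$ (resp. $\mathcal{K}_i$) and $b_i$; in $\mathcal{F}^T_{\mathrm{RatNN}}$, $\mathcal{F}^T_{\mathrm{RatCNN}}$ the coefficients of the $\rho_i\in R^s_s$ are parameters as well (only parameters for which $\operatorname{im}(\rho_L)\subseteq[-t,t]$ are considered). For data $X=(x_1|\cdots|x_n)\in\mathbb{R}^{d_0\times n}$, $f(X)=(f(x_1)|\cdots|f(x_n))\in\mathbb{R}^{d_L\times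 n}$ and $\mathcal{F}(X)=\{f(X):f\in\mathcal{F}\}$. $\mathcal{N}(W,\varepsilon)$ is the minimal cardinality of a subset $S\subseteq W$ such that every point of $W$ is within Euclidean distance $\varepsilon$ of some point of $S$. $\log$ is the natural logarithm. *)

(* Defs.v *)
From HB Require Import structures.
From mathcomp Require Import all_boot all_order all_algebra.
From mathcomp Require Import all_classical all_reals all_analysis.

Set Implicit Arguments.
Unset Strict Implicit.
Unset Printing Implicit Defensive.

Import Order.TTheory GRing.Theory Num.Theory.

Local Open Scope classical_set_scope.
Local Open Scope ring_scope.

(** * Euclidean geometry of data matrices

    The library norm on ['M[R]_(m, n)] is the sup norm, so the Euclidean
    (Frobenius) distance is spelled out. *)

Section Covering.
Variables (R : realType) (m n : nat).
Implicit Types (W S : set 'M[R]_(m, n)) (eps : R).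

Definition eucl_dist (A B : 'M[R]_(m, n)) : R :=
  Num.sqrt (\sum_(i < m) \sum_(j < n) (A i j - B i j) ^+ 2).

(* [-oo] on the empty set *)
Definition eucl_diam W : \bar R :=
  ereal_sup [set (eucl_dist A B)%:E | A in W & B in W].

Definition is_cover W eps S : Prop :=
  S `<=` W /\ forall A, W A -> exists2 B, S B & eucl_dist A B <= eps.

(* The infimum ranges over cardinalities of finite covers, hence it is a
   minimum when there is one, and [+oo] otherwise. *)
Definition covering_number W eps : \bar R :=
  ereal_inf [set k%:R%:E | k in
    [set k : nat | exists2 S, is_cover W eps S & (S #= `I_k)%card]].

End Covering.

(** * Hypothesis classes of partial maps *)

Section Classes.
Variables (R : realType) (p q : nat).

Definition hclass := set ('cV[R]_p -> option 'cV[R]_q).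

(* The set of all [(f(x_1)|...|f(x_n))] with [f] in the class and defined at
   every column [x_j] of [X]. *)
Definition class_eval (F : hclass) n (X : 'M[R]_(p, n)) : set 'M[R]_(q, n) :=
  [set Y | exists2 f, F f & forall j, f (col j X) = Some (col j Y)].

(* [lne] is the natural logarithm on [[0, +oo]], with [lne 0 = -oo]. *)
Definition sup_log_covering (F : hclass) (n : nat) (eps : R) : \bar R :=
  ereal_sup [set lne (covering_number (class_eval F X) eps)
            | X in [set: 'M[R]_(p, n)]].

End Classes.

(** * Univariate rational functions *)

Section RationalFunctions.
Variable R : realType.

(* A numerator and a denominator, not necessarily coprime; the function is
   defined off the zeros of the denominator. *)
Definition ratfun : Type := ({poly R} * {poly R})%type.

Implicit Type rho : ratfun.

(* [size] of a polynomial is its degree plus one, and [size 0 = 0]. *)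
Definition in_ratfun (a b : nat) rho : Prop :=
  [/\ (size rho.1 <= a.+1)%N, (size rho.2 <= b.+1)%N & rho.2 != 0].

Definition ratfun_dom rho : set R := [set x | rho.2.[x] != 0].

Definition ratfun_val rho (x : R) : R := rho.1.[x] / rho.2.[x].

Definition ratfun_im rho : set R := ratfun_val rho @` ratfun_dom rho.

Definition activate rho m (v : 'cV[R]_m) : option 'cV[R]_m :=
  if [forall i, rho.2.[v i 0] != 0] then Some (map_mx (ratfun_val rho) v)
  else None.

End RationalFunctions.

(** * Networks

    Layers are numbered from 0: the layer [l] maps [R^(d l)] to [R^(d l.+1)]
    and has activation [rho l].  Families of layers are indexed by all of
    [nat]; a network of depth [L] only uses the indices [l < L]. *)

Section Networks.
Variables (R : realType) (d : nat -> nat).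

Fixpoint network (g : forall l, 'cV[R]_(d l) -> 'cV[R]_(d l.+1))
    (rho : nat -> ratfun R) (L : nat) (x : 'cV[R]_(d 0%N)) :
    option 'cV[R]_(d L) :=
  if L is l.+1
  then obind (fun z => activate (rho l) (g l z)) (network g rho l x)
  else Some x.

Definition fc_layer (A : forall l, 'M[R]_(d l.+1, d l))
    (b : forall l, 'cV[R]_(d l.+1)) l (x : 'cV[R]_(d l)) : 'cV[R]_(d l.+1) :=
  A l *m x + b l.

Definition ratNN (rho : nat -> ratfun R) (L : nat) : hclass R (d 0%N) (d L) :=
  [set f | exists A b, f = network (fc_layer A b) rho L].

Definition ratNN_trainable (s : nat) (t : R) (L : nat) :
    hclass R (d 0%N) (d L) :=
  [set f | exists A b rho,
    [/\ forall l, (l < L)%N -> in_ratfun s s (rho l),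
        ratfun_im (rho L.-1) `<=` `[- t, t]
      & f = network (fc_layer A b) rho L]].

Definition fc_nparams (L : nat) : nat :=
  \sum_(l < L) (d l.+1 * d l + d l.+1).

End Networks.

Arguments ratNN {R} d rho L.
Arguments ratNN_trainable {R} d s t L.

(* the coefficients of [L] numerators and [L] denominators of degree [s] *)
Definition act_nparams (s L : nat) : nat := L * (2 * s.+1).

(** * Convolutions *)

(* Stride and amount of padding along one of the two image axes. *)
Record axis_geom := AxisGeom { stride : nat; pad_before : nat; pad_after : nat }.

Definition padded_size (a : axis_geom) (h : nat) : nat :=
  pad_before a + h + pad_after a.

Fixpoint axis_size (h0 k : nat) (a : nat -> axis_geom) (l : nat) : nat :=
  if l is l'.+1
  then ((padded_size (a l') (axis_size h0 k a l') - k) %/ stride (a l')).+1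
  else h0.

Definition valid_axis (h0 k : nat) (a : nat -> axis_geom) (L : nat) : Prop :=
  (0 < h0)%N /\ forall l, (l < L)%N ->
    (0 < stride (a l))%N /\ (k <= padded_size (a l) (axis_size h0 k a l))%N.

(* Position in the image of a position [i] of the padded image; [None] in the
   padding. *)
Definition unpad (a : axis_geom) h (i : nat) : option 'I_h :=
  if (pad_before a <= i)%N then insub (i - pad_before a)%N else None.

(* An image with [c] channels of size [h * w] is a vector of length
   [c * (h * w)]; its entry in channel [o] at position [(y, z)] has index
   [mxvec_index o (mxvec_index y z)]. *)
Section Convolution.
Variable R : realType.

Definition image_of_col c h w (v : 'cV[R]_(c * (h * w)))
    (o : 'I_c) (y : 'I_h) (z : 'I_w) : R :=
  v (mxvec_index o (mxvec_index y z)) 0.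

Definition col_of_image c h w (I : 'I_c -> 'I_h -> 'I_w -> R) :
    'cV[R]_(c * (h * w)) :=
  (mxvec (\matrix_(o < c) mxvec (\matrix_(y < h, z < w) I o y z)))^T.

Definition padded_entry c h w (av ah : axis_geom) (tau : R)
    (v : 'cV[R]_(c * (h * w))) (o : 'I_c) (i j : nat) : R :=
  if (unpad av h i, unpad ah w j) is (Some y, Some z)
  then image_of_col v o y z else tau.

(* Convolution is the cross-correlation customary for neural networks (no
   reflection of the kernel). *)
Definition convolve {c c' h w h' w' k : nat} (av ah : axis_geom) (tau : R)
    (K : 'M['M[R]_k]_(c', c)) (v : 'cV[R]_(c * (h * w))) :
    'cV[R]_(c' * (h' * w')) :=
  col_of_image (fun (o' : 'I_c') (y : 'I_h') (z : 'I_w') =>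
    \sum_(o < c) \sum_(u < k) \sum_(r < k)
      K o' o u r *
      padded_entry av ah tau v o (y * stride av + u) (z * stride ah + r)).

End Convolution.

(** * Convolutional networks *)

(* channels, kernel size, input height and width, geometry of the layers along
   the vertical and horizontal axes, padding constants *)
Record cnn_arch (R : Type) := CnnArch {
  channels : nat -> nat;
  ksize : nat;
  height0 : nat;
  width0 : nat;
  vaxis : nat -> axis_geom;
  haxis : nat -> axis_geom;
  pad_value : nat -> R }.

Section ConvolutionalNetworks.
Variables (R : realType) (a : cnn_arch R).

Definition height (l : nat) : nat := axis_size (height0 a) (ksize a) (vaxis a) l.
Definition width (l : nat) : nat := axis_size (width0 a) (ksize a) (haxis a) l.

Definition cnn_dim (l : nat) : nat := channels a l * (height l * width l).

Definition valid_cnn (L : nat) : Prop :=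
  [/\ (0 < ksize a)%N, forall l, (l <= L)%N -> (0 < channels a l)%N,
      valid_axis (height0 a) (ksize a) (vaxis a) L
    & valid_axis (width0 a) (ksize a) (haxis a) L].

Definition conv_layer
    (K : forall l, 'M['M[R]_(ksize a)]_(channels a l.+1, channels a l))
    (b : forall l, 'cV[R]_(cnn_dim l.+1)) l (x : 'cV[R]_(cnn_dim l)) :
    'cV[R]_(cnn_dim l.+1) :=
  convolve (vaxis a l) (haxis a l) (pad_value a l) (K l) x + b l.

Definition ratCNN (rho : nat -> ratfun R) (L : nat) :
    hclass R (cnn_dim 0) (cnn_dim L) :=
  [set f | exists K b, f = network (conv_layer K b) rho L].

Definition ratCNN_trainable (s : nat) (t : R) (L : nat) :
    hclass R (cnn_dim 0) (cnn_dim L) :=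
  [set f | exists K b rho,
    [/\ forall l, (l < L)%N -> in_ratfun s s (rho l),
        ratfun_im (rho L.-1) `<=` `[- t, t]
      & f = network (conv_layer K b) rho L]].

Definition cnn_nparams (L : nat) : nat :=
  \sum_(l < L) (channels a l.+1 * channels a l * ksize a ^ 2 + cnn_dim l.+1).

End ConvolutionalNetworks.

Arguments ratCNN {R} a rho L.
Arguments ratCNN_trainable {R} a s t L.

(** * The bounds *)

(* [P] is the factor that depends on the architecture. *)
Definition log_covering_bound (R : realType) (c t eps : R)
    (N m s L : nat) (P : R) : R :=
  N%:R * ln (t / eps) +
  N.+1%:R * ln (c * N%:R * m%:R `^ (5 / 2) * s%:R ^+ L * P).

(* Main.v *)
Require Import Defs.
From mathcomp Require Import all_boot all_order all_algebra.
From mathcomp Require Import all_classical all_reals all_analysis.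
From mathcomp Require Import ring lra zify.

Set Implicit Arguments.
Unset Strict Implicit.
Unset Printing Implicit Defensive.

Import Order.TTheory GRing.Theory Num.Theory.
Import numFieldNormedType.Exports.

Local Open Scope classical_set_scope.
Local Open Scope ring_scope.

(** The covering number is bounded by counting sign patterns of polynomials in
    the parameters of the network.

    Fix the data.  Every entry [f(x_j)_i] is a quotient [p / q] of two
    polynomials in the [N] parameters.  Homogenizing the activations gives the
    recursion [D_(l+1) = s * (r_l * D_l + 1) + 1] for the degree, where [r_l] is
    the number of inputs that one output of the layer [l] sees ([d_l] for full
    layers, [c_l * k ^ 2] for convolutions), and hence
    [D <= 2 * L * s ^ L * \prod_(1 <= j < L) r_j] with [L <= N]
    ([ratfrac_network], [net_degree_le]).

    Let [m = n * d_L].  Points of [F(X)] at mutual distance greater than [eps]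
    differ by more than [delta = eps / sqrt m] in some entry, so one of about
    [2 * t / delta] equally spaced thresholds [theta] separates them there, and
    the polynomial [(p - theta * q) * q] has opposite signs at their
    parameters.  The number of such points is therefore at most the number of
    sign patterns of these polynomials ([separated_card]), and a maximal
    separated set is a cover ([covering_number_le_separated]).

    Sign patterns are counted as in the theorems of Milnor and Warren
    ([sign_patterns]).  If [F] is the product of the squares of the polynomials
    and [M] its degree, then [F - eta * \sum_i x_i ^ (M + 2)] has, for small
    [eta], an interior maximum in every sign region under consideration
    ([critical_point]).  The maxima are distinct solutions of equations
    [x_i ^ (M + 1) = g_i(x)] with [g_i] of degree at most [M].  Such a system
    has at most [(M + 1) ^ N] solutions for reasons of linear algebra
    ([root_count]): modulo the equations, the monomials with all exponents at
    most [M] span all polynomials, while polynomials realize every function on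
    a finite set.

    Altogether there are at most [(20 * D * m ^ (3/2) * t / eps) ^ N] separated
    points, which the stated bound with [c = 40] absorbs. *)

(** * Polynomial functions of bounded total degree *)

Section PolyFun.
Variables (R : realType) (I : finType).
Implicit Types (v : I -> R) (al be : {ffun I -> nat}).
Implicit Types s : seq (R * {ffun I -> nat}).

Definition mon al v : R := \prod_i v i ^+ al i.

Definition madd al be : {ffun I -> nat} := [ffun i => al i + be i]%N.

Definition mdeg al : nat := \sum_i al i.

Definition polyval s v : R := \sum_(m <- s) m.1 * mon m.2 v.

Definition polydeg_le d s : bool := all (fun m => mdeg m.2 <= d)%N s.

(** The variables are functions on an arbitrary type [T], the entries of
    [X : T -> I -> R].  For networks, [T] consists of families of weights
    indexed by all layers, and the variables are the finitely many weights of
    the first [L] of them. *)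
Definition polyfun (T : Type) (X : T -> I -> R) d (f : T -> R) : Prop :=
  exists2 s, polydeg_le d s & forall x, f x = polyval s (X x).

Lemma mon0 v : mon [ffun=> 0%N] v = 1.
Proof. by rewrite /mon big1 // => i _; rewrite ffunE expr0. Qed.

Lemma monD al be v : mon (madd al be) v = mon al v * mon be v.
Proof. by rewrite /mon -big_split; apply: eq_bigr => i _; rewrite ffunE exprD. Qed.

Lemma mdegD al be : mdeg (madd al be) = (mdeg al + mdeg be)%N.
Proof. by rewrite /mdeg -big_split; apply: eq_bigr => i _; rewrite ffunE. Qed.

Definition single (i : I) k : {ffun I -> nat} :=
  [ffun j => if j == i then k else 0%N].

Lemma mon_single i k v : mon (single i k) v = v i ^+ k.
Proof.
rewrite /mon (bigD1 i) //= big1 ?mulr1; first by rewrite ffunE eqxx.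
by move=> j /negbTE ji; rewrite ffunE ji expr0.
Qed.

Lemma mdeg_single i k : mdeg (single i k) = k.
Proof.
rewrite /mdeg (bigD1 i) //= big1 ?addn0; first by rewrite ffunE eqxx.
by move=> j /negbTE ji; rewrite ffunE ji.
Qed.

Section Closure.
Variables (T : Type) (X : T -> I -> R).
Implicit Types f g : T -> R.

Lemma polyfun_mon d al : (mdeg al <= d)%N -> polyfun X d (fun x => mon al (X x)).
Proof.
move=> ad; exists [:: (1, al)]; first by rewrite /polydeg_le /= ad.
by move=> x; rewrite /polyval big_seq1 mul1r.
Qed.

Lemma polyfun_cst d c : polyfun X d (fun=> c).
Proof.
exists [:: (c, [ffun=> 0%N])].
  by rewrite /polydeg_le /= /mdeg big1 // => i; rewrite ffunE.
by move=> x; rewrite /polyval big_seq1 mon0 mulr1.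
Qed.

Lemma polyfun_var i : polyfun X 1 (fun x => X x i).
Proof.
exists [:: (1, single i 1)]; first by rewrite /polydeg_le /= mdeg_single.
by move=> x; rewrite /polyval big_seq1 mon_single mul1r expr1.
Qed.

Lemma polyfunW d e f : (d <= e)%N -> polyfun X d f -> polyfun X e f.
Proof.
move=> de [s sd fs]; exists s => //.
by apply: sub_all sd => m /leq_trans; apply.
Qed.

Lemma polyfunD d f g :
  polyfun X d f -> polyfun X d g -> polyfun X d (fun x => f x + g x).
Proof.
move=> [s sd fs] [r rd gr]; exists (s ++ r).
  by rewrite /polydeg_le all_cat; apply/andP.
by move=> x; rewrite fs gr /polyval big_cat.
Qed.

Lemma polyfunM d e f g :
  polyfun X d f -> polyfun X e g -> polyfun X (d + e) (fun x => f x * g x).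
Proof.
move=> [s sd fs] [r rd gr].
exists [seq (m.1 * k.1, madd m.2 k.2) | m <- s, k <- r].
  apply/allP => _ /allpairsP [[m k] /= [ms kr ->]] /=; rewrite mdegD leq_add //.
    exact: (allP sd).
  exact: (allP rd).
move=> x; rewrite fs gr /polyval big_allpairs_dep /= big_distrl /=.
apply: eq_bigr => m _; rewrite big_distrr /=.
by apply: eq_bigr => k _; rewrite monD mulrACA.
Qed.

Lemma polyfunZ d c f : polyfun X d f -> polyfun X d (fun x => c * f x).
Proof. by move=> fd; exact: (polyfunM (polyfun_cst 0 c) fd). Qed.

Lemma polyfunB d f g :
  polyfun X d f -> polyfun X d g -> polyfun X d (fun x => f x - g x).
Proof.
move=> fd /(polyfunZ (-1)) gd.
by under eq_fun do rewrite -[X in _ - X]mul1r -mulNr; exact: polyfunD.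
Qed.

Lemma polyfunXn d k f : polyfun X d f -> polyfun X (k * d) (fun x => f x ^+ k).
Proof.
move=> fd; elim: k => [|k IHk].
  by under eq_fun do rewrite expr0; exact: polyfun_cst.
by under eq_fun do rewrite exprS; rewrite mulSn; exact: polyfunM.
Qed.

Lemma polyfun_sum (J : Type) (r : seq J) d (F : J -> T -> R) :
  (forall j, polyfun X d (F j)) -> polyfun X d (fun x => \sum_(j <- r) F j x).
Proof.
move=> Fd; elim: r => [|j r IHr].
  by under eq_fun do rewrite big_nil; exact: polyfun_cst.
by under eq_fun do rewrite big_cons; exact: polyfunD.
Qed.

Lemma polyfun_prod (J : finType) (P : pred J) d (F : J -> T -> R) :
  (forall j, polyfun X d (F j)) ->
  polyfun X (#|P| * d) (fun x => \prod_(j | P j) F j x).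
Proof.
move=> Fd; under eq_fun do rewrite -big_enum /=.
rewrite cardE; elim: (enum P) => [|j r IHr].
  by under eq_fun do rewrite big_nil; exact: polyfun_cst.
by under eq_fun do rewrite big_cons; rewrite mulSn; exact: polyfunM.
Qed.

End Closure.
End PolyFun.

(** * Counting the solutions of a triangular system *)

Section RootCount.
Variables (R : realType) (I : finType).

(** Over an ordered field, a sum of squares of coordinate differences vanishes
    at a single point; a product of such sums isolates one point of a finite
    set. *)
Lemma isolating_polyfun (k : nat) (v : 'I_k -> I -> R) (b : 'I_k) :
  injective v ->
  exists d, exists2 f, polyfun v d f & forall c, (f c != 0) = (c == b).
Proof.
move=> vinj; pose f c := \prod_(a | a != b) \sum_i (v c i - v a i) ^+ 2.
exists (#|predC1 b| * (2 * 1))%N, f.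
  apply: (polyfun_prod (predC1 b)) => a; apply: polyfun_sum => i.
  by apply/polyfunXn/polyfunB; [exact: polyfun_var | exact: polyfun_cst].
move=> c; case: (eqVneq c b) => [->|cb]; last first.
  apply/negbTE; rewrite negbK /f (bigD1 c) //= big1 ?mul0r // => i _.
  by rewrite subrr expr0n.
apply/prodf_neq0 => a ab; apply: contra_neq ab => sum0; apply/vinj/funext => i.
move/eqP: sum0; rewrite psumr_eq0 => [/allP /(_ i)|j _]; last exact: sqr_ge0.
by rewrite mem_index_enum sqrf_eq0 subr_eq0 => /(_ isT) /eqP ->.
Qed.

(** On the solution set, replacing a factor [v i ^+ e.+1] by [g i] lowers the
    degree of a monomial.  Hence the [e.+1 ^ #|I|] monomials with all exponents
    at most [e] span all polynomial functions, which on [k] points form a space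
    of dimension [k].  In the proof, the rows of [M] are these monomials. *)
Lemma root_count (k e : nat) (v : 'I_k -> I -> R) (g : I -> 'I_k -> R) :
  injective v -> (forall i, polyfun v e (g i)) ->
  (forall i a, v a i ^+ e.+1 = g i a) -> (k <= e.+1 ^ #|I|)%N.
Proof.
move=> vinj gpoly veq.
pose low : finType := {ffun I -> 'I_e.+1}.
pose expo (al : low) : {ffun I -> nat} := [ffun i => al i : nat].
pose ev (f : 'I_k -> R) : 'rV[R]_k := \row_a f a.
pose M : 'M[R]_(#|low|, k) := \matrix_(r, a) mon (expo (enum_val r)) (v a).
have ev_poly_ind d :
    (forall al : {ffun I -> nat}, (mdeg al <= d)%N ->
      (ev (fun a => mon al (v a)) <= M)%MS) ->
    forall f, polyfun v d f -> (ev f <= M)%MS.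
  move=> IH f [s /allP sd fs].
  have -> : ev f = \sum_(m <- s) m.1 *: ev (fun a => mon m.2 (v a)).
    apply/rowP => a; rewrite summxE mxE fs /polyval.
    by apply: eq_bigr => m _; rewrite !mxE.
  rewrite big_seq; apply: summx_sub => m ms; apply: scalemx_sub.
  by apply: IH; apply: sd.
have ev_low (al : {ffun I -> nat}) : (forall i, al i < e.+1)%N ->
    (ev (fun a => mon al (v a)) <= M)%MS.
  move=> lowal.
  have -> : ev (fun a => mon al (v a)) =
      row (enum_rank ([ffun i => Ordinal (lowal i)] : low)) M.
    apply/rowP => a; rewrite !mxE enum_rankK; congr (mon _ _).
    by apply/ffunP => i; rewrite !ffunE.
  exact: row_sub.
have ev_mon d (al : {ffun I -> nat}) : (mdeg al <= d)%N ->
    (ev (fun a => mon al (v a)) <= M)%MS.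
  elim: d al => [|d IHd] al ald; have [/forallP/ev_low //|] :=
    boolP [forall i, al i < e.+1]%N; rewrite negb_forall => /existsP [i];
    rewrite -leqNgt => ei.
    by move: ald; rewrite /mdeg (bigD1 i) //=; case: (al i) ei.
  pose be : {ffun I -> nat} := [ffun j => if j == i then (al i - e.+1)%N else al j].
  have alE : al = madd be (single i e.+1).
    by apply/ffunP => j; rewrite !ffunE; case: eqP => [->|]; rewrite ?subnK ?addn0.
  move: ald; rewrite alE mdegD mdeg_single addnS ltnS => bed.
  apply: (ev_poly_ind d IHd); apply: polyfunW bed _.
  under eq_fun do rewrite monD mon_single veq.
  by apply: polyfunM => //; exact: polyfun_mon.
have ev_poly d f : polyfun v d f -> (ev f <= M)%MS.
  by apply: ev_poly_ind => al; exact: ev_mon.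
suff : (1%:M <= M)%MS.
  move/mxrankS; rewrite mxrank1 => /leq_trans -> //.
  by rewrite (leq_trans (rank_leq_row _)) // card_ffun card_ord.
apply/row_subP => b; rewrite row1.
have [d [f fpoly fb]] := isolating_polyfun b vinj.
have -> : delta_mx 0 b = (f b)^-1 *: ev f.
  apply/rowP => c; rewrite !mxE eqxx /=.
  case: (eqVneq c b) => [->|cb]; first by rewrite mulVf // fb.
  by have := fb c; rewrite (negbTE cb) => /negbFE/eqP ->; rewrite mulr0.
by apply: scalemx_sub; exact: ev_poly fpoly.
Qed.

End RootCount.

(** * Partial derivatives, growth and continuity of polynomial functions *)

Lemma deriv0_local_max (R : realType) (p : {poly R}) (c : R) :
  (\forall u \near c, p.[u] <= p.[c]) -> p^`().[c] = 0.
Proof.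
move=> /nbhs_ballP [e /= e0 pmax].
have : is_derive c 1 (horner p) 0.
  apply: (@derive1_at_max _ _ (c - e) (c + e)).
  - by rewrite lerBlDr -addrA lerDl addr_ge0 // ltW.
  - by move=> *; exact: derivable_horner.
  - by rewrite in_itv /= ltrBlDr !ltrDl e0.
  - move=> u; rewrite in_itv /= => uc; apply: pmax.
    by rewrite -ball_normE /= ltr_distlC.
by move=> dp; rewrite derivE derive1E derive_val.
Qed.

Section Line.
Variables (R : realType) (I : finType).
Implicit Types (v : I -> R) (s : seq (R * {ffun I -> nat})).

Definition setcoord v i (u : R) : I -> R := fun j => if j == i then u else v j.

Definition line_poly s v i : {poly R} :=
  \sum_(m <- s) (m.1 * \prod_(j | j != i) v j ^+ m.2 j) *: 'X^(m.2 i).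

Definition lower i (al : {ffun I -> nat}) : {ffun I -> nat} :=
  [ffun j => al j - (j == i)]%N.

Definition partial i s : seq (R * {ffun I -> nat}) :=
  [seq (m.1 *+ m.2 i, lower i m.2) | m : R * {ffun I -> nat} <- s].

Lemma setcoord_id v i : setcoord v i (v i) = v.
Proof. by apply/funext => j; rewrite /setcoord; case: eqP => [->|]. Qed.

Lemma line_polyE s v i u : (line_poly s v i).[u] = polyval s (setcoord v i u).
Proof.
rewrite /line_poly horner_sum; apply: eq_bigr => m _.
rewrite hornerZ hornerXn -mulrA; congr (_ * _).
rewrite /mon [in RHS](bigD1 i) //= /setcoord eqxx mulrC; congr (_ * _).
by apply: eq_bigr => j /negbTE ->.
Qed.

Lemma deriv_line_poly s v i :
  (line_poly s v i)^`().[v i] = polyval (partial i s) v.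
Proof.
rewrite /line_poly linear_sum horner_sum /polyval big_map; apply: eq_bigr => m _.
rewrite /= derivZ derivXn hornerZ hornerMn hornerXn /= !mulrnAr mulrnAl -mulrA.
congr (_ * _ *+ _); rewrite /mon [in RHS](bigD1 i) //= ffunE eqxx subn1 mulrC.
by congr (_ * _); apply: eq_bigr => j /negbTE ji; rewrite ffunE ji subn0.
Qed.

Lemma polydeg_partial d i s : polydeg_le d s -> polydeg_le d (partial i s).
Proof.
rewrite /polydeg_le all_map; apply: sub_all => m /=; apply: leq_trans.
by apply: leq_sum => j _; rewrite ffunE leq_subr.
Qed.

Lemma polyval_growth d s v (r : R) : polydeg_le d s -> 1 <= r ->
  (forall i, `|v i| <= r) -> `|polyval s v| <= (\sum_(m <- s) `|m.1|) * r ^+ d.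
Proof.
move=> /allP sd r1 vr; rewrite (le_trans (ler_norm_sum _ _ _)) // big_distrl /=.
rewrite big_seq [leRHS]big_seq; apply: ler_sum => m ms.
rewrite normrM ler_wpM2l // /mon normr_prod.
rewrite (@le_trans _ _ (\prod_i r ^+ m.2 i)) //.
  apply: ler_prod => i _; rewrite normr_ge0 normrX /=.
  by apply: lerXn2r; rewrite ?nnegrE // (le_trans _ r1).
by rewrite -expr_sum; apply: ler_weXn2l => //; exact: sd.
Qed.

(** The space [R^I], as row vectors, with its topology. *)
Definition rcoord (x : 'rV[R]_#|I|) : I -> R := fun i => x 0 (enum_rank i).

Lemma continuous_polyval s : continuous (fun x : 'rV[R]_#|I| => polyval s (rcoord x)).
Proof.
have cmon al : continuous (fun x : 'rV[R]_#|I| => mon al (rcoord x)).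
  rewrite /mon; elim: (index_enum I) => [|i r IHr].
    rewrite (_ : (fun _ => _) = cst 1); first exact: cst_continuous.
    by apply/funext => x; rewrite big_nil.
  rewrite (_ : (fun _ => _) = fun x : 'rV[R]_#|I| =>
      rcoord x i ^+ al i * \prod_(j <- r) rcoord x j ^+ al j); last first.
    by apply/funext => x; rewrite big_cons.
  move=> x.
  have ci : rcoord z i @[z --> x] --> rcoord x i by exact: coord_continuous.
  exact: (cvgM (cvg_comp _ _ ci (@exprn_continuous _ (al i) _)) (IHr x)).
rewrite /polyval; elim: s => [|m s IHs].
  rewrite (_ : (fun _ => _) = cst 0); first exact: cst_continuous.
  by apply/funext => x; rewrite big_nil.
rewrite (_ : (fun _ => _) = fun x : 'rV[R]_#|I| =>
    m.1 * mon m.2 (rcoord x) + \sum_(m <- s) m.1 * mon m.2 (rcoord x)); last first.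
  by apply/funext => x; rewrite big_cons.
by move=> x; exact: (cvgD (cvgM (cvg_cst _) (cmon _ x)) (IHs x)).
Qed.

End Line.

(** * Counting sign patterns *)

Section SignPatterns.
Variables (R : realType) (I J : finType) (D : nat).
Variable h : J -> seq (R * {ffun I -> nat}).
Hypothesis hD : forall j, polydeg_le D (h j).

Let M : nat := #|J| * (2 * D).

Let pow_ge0 (u : R) : 0 <= u ^+ M.+2.
Proof. by rewrite -addn2 /M mulnCA -mulnSr exprM exprn_ge0 ?sqr_ge0. Qed.

(** The product [F] of the squares of the [h j] vanishes on the boundary of the
    closed sign region of [x].  The perturbation [F - eta * \sum_i v_i ^ (M + 2)]
    tends to minus infinity, because its exponent is even and exceeds the degree
    [M] of [F]; it is positive at [x].  So it attains a positive maximum over the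
    region, at a point [y] where [F] is positive and which is therefore interior.
    The same perturbation gives the critical point equations at [y] the form
    that [root_count] asks for. *)
Lemma critical_point (x : I -> R) (sF : seq (R * {ffun I -> nat})) (eta : R) :
    polydeg_le M sF ->
    (forall v, polyval sF v = \prod_j polyval (h j) v ^+ 2) ->
    0 < eta -> eta * \sum_i x i ^+ M.+2 < polyval sF x ->
  exists y : I -> R, (forall j, 0 < polyval (h j) y * polyval (h j) x) /\
    forall i, y i ^+ M.+1 = (eta * M.+2%:R)^-1 * polyval (partial i sF) y.
Proof.
move=> sFM sFE eta0 Fx.
pose sG := sF ++ [seq (- eta, single i M.+2) | i <- enum I].
have sGE v : polyval sG v = polyval sF v - eta * \sum_i v i ^+ M.+2.
  rewrite /sG /polyval big_cat big_map /= big_enum mulr_sumr -sumrN.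
  by congr (_ + _); apply: eq_bigr => i _; rewrite mon_single mulNr.
pose region v := forall j, 0 <= polyval (h j) v * polyval (h j) x.
pose A := [set z : 'rV[R]_#|I| | region (rcoord z) /\ 0 <= polyval sG (rcoord z)].
have cG := @continuous_polyval _ _ sG.
pose rowx : 'rV[R]_#|I| := \row_r x (enum_val r).
have rcoord_row v : rcoord (\row_r v (enum_val r)) = v.
  by apply/funext => i; rewrite /rcoord mxE enum_rankK.
have Gx : 0 < polyval sG x by rewrite sGE subr_gt0.
have Ax : A rowx.
  by rewrite /A /= rcoord_row; split=> [j|]; [rewrite -expr2 sqr_ge0 | exact: ltW].
have closedA : closed A.
  rewrite (_ : A = (\bigcap_(j in [set: J])
      [set z | 0 <= polyval (h j) (rcoord z) * polyval (h j) x])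
      `&` [set z | 0 <= polyval sG (rcoord z)]); last first.
    by apply/seteqP; split=> z /= [zr Gz]; split=> // j; [move=> _|]; exact: zr.
  have closed_nonneg (f : 'rV[R]_#|I| -> R) : continuous f -> closed [set z | 0 <= f z].
    by move=> cf; apply: (@closed_comp _ _ f [set u | 0 <= u]) => //; exact: closed_ge.
  apply: closedI; last exact: closed_nonneg.
  apply: closed_bigI => j _; apply: closed_nonneg => z.
  exact: (cvgM (@continuous_polyval _ _ (h j) z) (cvg_cst _)).
have boundedA : bounded_set A.
  (* [F <= C * r ^ M < eta * r ^ (M + 2)] on the sphere of radius [r] for the
     sup norm once [r > 1 + C / eta] *)
  pose C := \sum_(m <- sF) `|m.1|.
  have C0 : 0 <= C by apply: sumr_ge0.
  exists (1 + C / eta); split=> [|B CB z [_ Gz]]; first exact: num_real.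
  apply: le_trans (ltW CB); rewrite leNgt; apply/negP => zbig.
  set r := `|z| in zbig.
  have r1 : 1 < r by rewrite (le_lt_trans _ zbig) // lerDl divr_ge0 // ltW.
  have r0 : 0 < r by rewrite (lt_trans _ r1).
  have zr i : `|rcoord z i| <= r.
    rewrite (_ : r = mx_norm z) // mx_normrE.
    exact: (le_bigmax _ (fun ij => `|z ij.1 ij.2|) (0, enum_rank i)).
  have [i zi] : exists i, `|rcoord z i| = r.
    have [ij zj] := mx_norm_neq0 (lt0r_neq0 r0).
    by exists (enum_val ij.2); rewrite /rcoord enum_valK -(ord1 ij.1) -zj.
  move: Gz; rewrite sGE subr_ge0 leNgt => /negP; apply.
  apply: le_lt_trans (le_trans (ler_norm _) (polyval_growth sFM (ltW r1) zr)) _.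
  apply: (@lt_le_trans _ _ (eta * r ^+ M.+2)); last first.
    rewrite ler_wpM2l ?(ltW eta0) // (bigD1 i) //= -zi -normrX ger0_norm //.
    by rewrite lerDl sumr_ge0.
  rewrite -addn2 exprD mulrCA [ltLHS]mulrC ltr_pM2l ?exprn_gt0 //.
  rewrite mulrC -ltr_pdivrMr // expr2 -[ltLHS]mulr1 ltr_pM //.
    by rewrite divr_ge0 // ltW.
  by rewrite (le_lt_trans _ zbig) // lerDr.
have [c Ac cmax] := EVT_max_rV (ex_intro _ _ Ax) (bounded_closed_compact boundedA closedA)
  (continuous_subspaceT cG).
move: Ac; rewrite inE => -[creg Gc0].
set y := rcoord c in creg Gc0 cmax *.
have ymax v : region v -> polyval sG v <= polyval sG y.
  move=> vreg; have [Gv|/ltW Gv] := leP 0 (polyval sG v); last exact: le_trans Gc0.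
  rewrite -[v in leLHS]rcoord_row; apply: cmax.
  by rewrite inE /A /= rcoord_row.
have hy j : 0 < polyval (h j) y * polyval (h j) x.
  rewrite lt_neqAle creg andbT eq_sym.
  have : polyval sF y != 0.
    rewrite gt_eqF //; have := lt_le_trans Gx (ymax x _); rewrite sGE subr_gt0.
    move=> /(_ _)/le_lt_trans; apply; last by move=> j'; rewrite -expr2 sqr_ge0.
    by rewrite mulr_ge0 ?(ltW eta0) // sumr_ge0.
  have : polyval sF x != 0.
    rewrite gt_eqF // (le_lt_trans _ Fx) //.
    by rewrite mulr_ge0 ?(ltW eta0) // sumr_ge0.
  rewrite !sFE => /prodf_neq0 /(_ j isT) hx /prodf_neq0 /(_ j isT) hy.
  by move: hx hy; rewrite !sqrf_eq0 => hx hy; rewrite mulf_neq0.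
exists y; split=> // i.
have : (line_poly sG y i)^`().[y i] = 0.
  apply: deriv0_local_max; rewrite !line_polyE setcoord_id.
  have near_pos j : \forall u \near y i, 0 < (line_poly (h j) y i).[u] * polyval (h j) x.
    have /cvgr_gt : (line_poly (h j) y i).[u] * polyval (h j) x @[u --> y i] -->
        (line_poly (h j) y i).[y i] * polyval (h j) x.
      exact: (cvgM (@continuous_horner _ (line_poly (h j) y i) _) (cvg_cst _)).
    by apply; rewrite line_polyE setcoord_id; exact: hy.
  have := filter_forall (nbhs_filter (y i)) near_pos.
  apply: filterS => u hu; rewrite line_polyE; apply: ymax => j.
  by rewrite -line_polyE ltW.
rewrite deriv_line_poly /partial map_cat -/(partial i sF) /polyval big_cat /=.
rewrite -map_comp big_map big_enum /= (bigD1 i) //= [X in _ + (_ + X)]big1; last first.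
  by move=> j ji; rewrite ffunE eq_sym (negbTE ji) mulr0n mul0r.
rewrite addr0 ffunE eqxx => /eqP; rewrite addr_eq0 => /eqP ->.
have -> : lower i (single i M.+2) = single i M.+1.
  by apply/ffunP => j; rewrite !ffunE; case: eqP; rewrite ?subn1.
rewrite mon_single mulNrn mulNr opprK -[eta *+ _]mulr_natr mulrA mulVf ?mul1r //.
by rewrite mulf_neq0 ?gt_eqF // pnatr_eq0.
Qed.

(** Each [x a] gives a critical point with the sign pattern of [x a], so distinct
    patterns give distinct critical points. *)
Lemma sign_patterns (k : nat) (x : 'I_k -> I -> R) :
  (forall a j, polyval (h j) (x a) != 0) ->
  (forall a b, a != b -> exists j, polyval (h j) (x a) * polyval (h j) (x b) < 0) ->
  (k <= (#|J| * (2 * D)).+1 ^ #|I|)%N.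
Proof.
move=> hx sep.
have [sF sFM sFE] : polyfun (fun v : I -> R => v) M
    (fun v => \prod_j polyval (h j) v ^+ 2).
  by apply: polyfun_prod => j; apply: polyfunXn; exists (h j).
pose S a := \sum_i x a i ^+ M.+2.
have Fx a : 0 < polyval sF (x a).
  by rewrite -sFE; apply: prodr_gt0 => j _; rewrite lt_neqAle sqr_ge0 eq_sym sqrf_eq0 hx.
have S0 a : 0 <= S a.
  by apply: sumr_ge0 => i _; exact: pow_ge0.
(* [eta = Q^-1] is small enough for the perturbation to stay positive at all
   the [x a] *)
pose Q := 1 + \sum_a S a / polyval sF (x a).
have Q0 : 0 < Q.
  by rewrite ltr_pwDl // sumr_ge0 // => a _; rewrite divr_ge0 ?S0 // ltW.
have etaS a : Q^-1 * S a < polyval sF (x a).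
  rewrite mulrC ltr_pdivrMr // mulrC -ltr_pdivrMr // /Q (bigD1 a) //=.
  rewrite addrA -addrA addrCA ltrDl ltr_pwDl // sumr_ge0 // => b _.
  by rewrite divr_ge0 ?S0 // ltW.
have Q0' : 0 < Q^-1 by rewrite invr_gt0.
have /choice[y yP] := fun a => critical_point sFM (fun v => esym (sFE v)) Q0' (etaS a).
apply: (@root_count _ _ _ _ y (fun i a => (Q^-1 * M.+2%:R)^-1 * polyval (partial i sF) (y a))).
- move=> a b yab; apply/eqP/negPn/negP => /sep [j].
  have [/(_ j) ya _] := yP a; have [/(_ j) yb _] := yP b; rewrite yab in ya.
  apply/negP; rewrite -leNgt.
  have : 0 < polyval (h j) (y b) ^+ 2 * (polyval (h j) (x a) * polyval (h j) (x b)).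
    by rewrite expr2 mulrACA mulr_gt0.
  by apply: contraTT; rewrite -ltNge -leNgt => /ltW; apply: mulr_ge0_le0; exact: sqr_ge0.
- move=> i; apply: polyfunZ; exists (partial i sF) => //.
  exact: polydeg_partial.
- by move=> i a; have [_ ->] := yP a.
Qed.

End SignPatterns.

(** * Separated values of rational functions *)

(** Used to shift the thresholds off the finitely many values at hand, as sign
    patterns are only counted at points where no polynomial vanishes. *)
Lemma itvoo_avoid (R : realType) (s : seq R) (a b : R) :
  a < b -> exists2 u, a < u < b & u \notin s.
Proof.
elim: s a b => [|x s IHs] a b ab; first by exists ((a + b) / 2); rewrite ?midf_lt.
have [u /andP[au ub] us] := IHs _ _ ab.
have [ux|ux] := eqVneq u x; last first.
  by exists u; rewrite ?au // in_cons negb_or ux.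
have [w /andP[aw wu] ws] := IHs _ _ au.
exists w; first by rewrite aw (lt_trans wu).
by rewrite in_cons negb_or ws -ux lt_eqF.
Qed.

Lemma threshold_between (R : realType) (t delta tau v w : R) (n : nat) :
    0 < tau < delta -> 2 * t / delta < n%:R ->
    - t <= v -> w <= t -> delta < w - v ->
  exists r : 'I_n, v < - t + tau + r%:R * delta < w.
Proof.
move=> /andP[tau0 taud] tn tv wt vw.
have d0 : 0 < delta by exact: lt_trans taud.
(* the integer part of [u] indexes the first threshold beyond [v] *)
pose u := (v + t - tau) / delta + 1.
have u0 : 0 <= u.
  rewrite /u -[X in _ + X](divff (lt0r_neq0 d0)) -mulrDl divr_ge0 ?ltW //.
  lra.
have /andP[] := truncn_itv u0; set r := Num.trunc u => ru ur.
have rd : r%:R * delta <= v + t - tau + delta.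
  by rewrite -ler_pdivlMr // mulrDl divff ?lt0r_neq0.
have rd' : v + t - tau < r%:R * delta.
  by rewrite -ltr_pdivrMr // -(ltrD2r 1) natr1.
have rn : (r < n)%N.
  by rewrite -(ltr_nat R) (lt_trans _ tn) // ltr_pdivlMr //; lra.
by exists (Ordinal rn) => /=; apply/andP; split; lra.
Qed.

Section RatFrac.
Variables (R : realType) (I : finType) (T : Type) (X : T -> I -> R).
Implicit Types (A : set T) (y : T -> R).

(** Networks are partial maps: [A] will consist of the parameters at which the
    network is defined on all data points, while [p] and [q] are polynomials on
    the whole parameter space. *)
Definition ratfrac A d y : Prop :=
  exists p q, [/\ polyfun X d p, polyfun X d q &
    forall x, A x -> q x != 0 /\ y x = p x / q x].

(** A threshold [theta] between two values of [y j = p / q] makes the polynomial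
    [(p - theta * q) * q = q ^ 2 * (y j - theta)] change sign; its degree is at
    most [d + d], and there are [n] thresholds for each [j]. *)
Lemma separated_card (J : finType) A d (y : J -> T -> R) (t delta : R)
    (n k : nat) (x : 'I_k -> T) :
  (forall j, ratfrac A d (y j)) ->
  0 < delta -> 2 * t / delta < n%:R ->
  (forall a, A (x a)) -> (forall a j, `|y j (x a)| <= t) ->
  (forall a b, a != b -> exists j, delta < `|y j (x a) - y j (x b)|) ->
  (k <= (#|J| * n * (2 * (d + d))).+1 ^ #|I|)%N.
Proof.
move=> yfrac d0 tn Ax yt sep.
have [p /choice[q pq]] := choice yfrac.
have [tau taud tauN] := itvoo_avoid
  [seq y arj.2 (x arj.1.1) + t - arj.1.2%:R * delta | arj : 'I_k * 'I_n * J] d0.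
pose theta (r : 'I_n) := - t + tau + r%:R * delta.
have thetaN a r j : y j (x a) != theta r.
  apply: contraNneq tauN => ya; apply/mapP; exists (a, r, j); first by rewrite mem_enum.
  by rewrite ya /theta; lra.
have /choice[h hP] (jr : J * 'I_n) : exists s, polydeg_le (d + d) s /\
    forall z, (p jr.1 z - theta jr.2 * q jr.1 z) * q jr.1 z = polyval s (X z).
  have [ppoly qpoly _] := pq jr.1.
  have [s sd sE] := polyfunM (polyfunB ppoly (polyfunZ (theta jr.2) qpoly)) qpoly.
  by exists s.
have hE a j r : polyval (h (j, r)) (X (x a)) =
    q j (x a) ^+ 2 * (y j (x a) - theta r).
  have [_ /(_ (x a)) <-] := hP (j, r); have [_ _ /(_ _ (Ax a))[q0 ->]] := pq j.
  by rewrite /=; field.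
have -> : (#|J| * n = #|{: J * 'I_n}|)%N by rewrite card_prod card_ord.
apply: (@sign_patterns _ _ _ (d + d) h _ _ (fun a => X (x a))).
- by move=> jr; have [] := hP jr.
- move=> a [j r]; rewrite hE; have [_ _ /(_ _ (Ax a))[q0 _]] := pq j.
  by rewrite mulf_neq0 ?expf_neq0 // subr_eq0.
- move=> a b /sep[j]; wlog ab : a b / y j (x a) < y j (x b).
    move=> H jd; have [/H/(_ jd)//|/H|ab] := ltgtP (y j (x a)) (y j (x b)).
      by rewrite distrC => /(_ jd)[r]; exists r; rewrite mulrC.
    by move: jd; rewrite ab subrr normr0 ltNge ltW.
  rewrite ltr0_norm ?subr_lt0 // opprB => jd.
  have ya := yt a j; have yb := yt b j; rewrite !ler_norml in ya yb.
  have [ya1 _] := andP ya; have [_ yb2] := andP yb.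
  have [r /andP[ar rb]] := threshold_between taud tn ya1 yb2 jd.
  exists (j, r); rewrite !hE mulrACA pmulr_rlt0 ?nmulr_rlt0 ?subr_lt0 ?subr_gt0 //.
  have [_ _ qn] := pq j; have [qa _] := qn _ (Ax a); have [qb _] := qn _ (Ax b).
  by rewrite mulr_gt0 // lt_neqAle sqr_ge0 eq_sym expf_neq0.
Qed.

End RatFrac.

(** * Covering numbers of rational images *)

Section CoveringBound.
Variables (R : realType) (m n : nat).
Implicit Types (W : set 'M[R]_(m, n)) (B C : 'M[R]_(m, n)).

Lemma eucl_dist_le B C (r : R) : 0 <= r ->
  (forall i j, `|B i j - C i j| <= r) -> eucl_dist B C <= Num.sqrt (m * n)%:R * r.
Proof.
move=> r0 BC; rewrite -[r in leRHS](ger0_norm r0) -sqrtr_sqr -sqrtrM ?ler0n //.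
apply: ler_wsqrtr; apply: (@le_trans _ _ (\sum_(i < m) \sum_(j < n) r ^+ 2)).
  apply: ler_sum => i _; apply: ler_sum => j _.
  by rewrite -real_normK ?num_real // lerXn2r ?nnegrE.
by rewrite !sumr_const !card_ord -mulrnA mulnC mulr_natl.
Qed.

Lemma eucl_distC B C : eucl_dist B C = eucl_dist C B.
Proof.
by congr Num.sqrt; apply: eq_bigr => i _; apply: eq_bigr => j _; rewrite -sqrrN opprB.
Qed.

Lemma eucl_dist0 B : eucl_dist B B = 0.
Proof.
by rewrite /eucl_dist big1 ?sqrtr0 // => i _; rewrite big1 // => j _; rewrite subrr expr0n.
Qed.

(** A maximal [eps]-separated family is a cover. *)
Lemma covering_number_le_separated W (eps : R) (K : nat) : 0 < eps ->
  (forall k (Y : nat -> 'M[R]_(m, n)), (forall i, (i < k)%N -> W (Y i)) ->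
    (forall i j, (i < k)%N -> (j < k)%N -> i != j -> eps < eucl_dist (Y i) (Y j)) ->
    (k <= K)%N) ->
  (covering_number W eps <= K%:R%:E)%E.
Proof.
move=> eps0 sepK.
pose sep k := `[< exists Y : nat -> 'M[R]_(m, n), (forall i, (i < k)%N -> W (Y i)) /\
  (forall i j, (i < k)%N -> (j < k)%N -> i != j -> eps < eucl_dist (Y i) (Y j)) >].
have sep0 : exists k, sep k by exists 0%N; apply/asboolP; exists (fun=> 0); split.
have sepK' k : sep k -> (k <= K)%N by move=> /asboolP[Y []]; exact: sepK.
case: (ex_maxnP sep0 sepK') => k /asboolP[Y [WY Ysep]] kmax.
apply: (@le_trans _ _ k%:R%:E); last first.
  by rewrite lee_fin ler_nat sepK' //; apply/asboolP; exists Y.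
apply: ereal_inf_lbound; exists k => //; exists (Y @` `I_k); last first.
  apply: inj_card_eq => i j; rewrite !inE /= => ik jk Yij.
  by apply: contraTeq (ltW eps0) => /(Ysep _ _ ik jk); rewrite Yij eucl_dist0 -ltNge.
split=> [_ [i ik <-]|B WB]; first exact: WY.
apply: contrapT => far.
have {}far i : (i < k)%N -> eps < eucl_dist B (Y i).
  by move=> ik; rewrite ltNge; apply/negP => near; apply: far; exists (Y i) => //; exists i.
suff /kmax : sep k.+1 by rewrite ltnn.
apply/asboolP; exists (fun i => if (i < k)%N then Y i else B); split=> [i _|i j].
  by case: ifP => // /WY.
rewrite !ltnS => ik jk ij; case: ltnP => ik'; case: ltnP => jk'.
- exact: Ysep.
- by rewrite eucl_distC far.
- exact: far.
- by case/eqP: ij; apply/eqP; rewrite eqn_leq (leq_trans ik) // (leq_trans jk).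
Qed.

Variables (I : finType) (T : Type) (X : T -> I -> R) (A : set T).
Variables (Y : T -> 'M[R]_(m, n)) (d : nat) (t eps : R).

(** The upper bound on [eps], which holds below the diameter, lets the
    threshold count [2 * t / delta + 1] be absorbed in a multiple of
    [t / delta]. *)
Lemma lne_covering_number_ratfrac W :
  (0 < m * n)%N -> (0 < d)%N -> 0 < eps <= Num.sqrt (m * n)%:R * (2 * t) ->
  (forall i j, ratfrac X A d (fun x => Y x i j)) ->
  (forall B, W B -> (exists2 x, A x & Y x = B) /\ forall i j, `|B i j| <= t) ->
  (lne (covering_number W eps) <=
    (#|I|%:R * (ln (t / eps) +
      ln (20 * d%:R * ((m * n)%:R * Num.sqrt (m * n)%:R))))%:E)%E.
Proof.
move=> mn0 d0 /andP[eps0 epst] Yfrac WY.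
set mu : R := (m * n)%:R in epst *.
have mu1 : 1 <= mu by rewrite ler1n.
have mu0 : 0 < mu by exact: lt_le_trans mu1.
have smu0 : 0 < Num.sqrt mu by rewrite sqrtr_gt0.
have t0 : 0 < t.
  by have := lt_le_trans eps0 epst; rewrite pmulr_rgt0 // pmulr_rgt0.
pose delta := eps / Num.sqrt mu.
have delta0 : 0 < delta by rewrite divr_gt0.
have one_le : 1 <= 2 * t / delta.
  by rewrite ler_pdivlMr // mul1r /delta ler_pdivrMr // mulrC.
pose N := (Num.trunc (2 * t / delta)).+1.
have /andP[] := truncn_itv (le_trans ler01 one_le); rewrite -/N => Nle Nlt.
pose K := ((m * n * N * (2 * (d + d))).+1 ^ #|I|)%N.
have covK : (covering_number W eps <= K%:R%:E)%E.
  apply: covering_number_le_separated => // k Z WZ Zsep.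
  have /choice[x xP] (a : 'I_k) : exists x, A x /\ Y x = Z a.
    by have [[x]] := WY _ (WZ a (ltn_ord a)); exists x.
  rewrite /K; have -> : (m * n = #|{: 'I_m * 'I_n}|)%N by rewrite card_prod !card_ord.
  apply: (@separated_card _ _ _ X _ A d (fun ij x => Y x ij.1 ij.2) t delta N k x) => //.
  - by move=> a; have [] := xP a.
  - by move=> a ij; have [_ ->] := xP a; have [_] := WY _ (WZ a (ltn_ord a)); apply.
  move=> a b ab; have [_ ->] := xP a; have [_ ->] := xP b.
  apply: contrapT => /forallNP near.
  have /= := Zsep a b (ltn_ord a) (ltn_ord b) ab; apply/negP; rewrite -leNgt.
  have -> : eps = Num.sqrt mu * delta by rewrite mulrC divfK // gt_eqF.
  apply: eucl_dist_le => [|i j]; first exact: ltW.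
  by rewrite leNgt; apply/negP => far; apply: (near (i, j)).
pose Q := t / eps * (20 * d%:R * (mu * Num.sqrt mu)).
have KQ : K%:R <= Q ^+ #|I|.
  rewrite /K natrX; apply: lerXn2r; rewrite ?nnegrE ?ler0n //.
    by rewrite !mulr_ge0 ?ler0n ?ltW ?invr_gt0.
  have d1 : 1 <= d%:R :> R by rewrite ler1n.
  have N1 : 1 <= N%:R :> R by rewrite ler1n.
  have N4 : N%:R <= 4 * t / delta by rewrite /N -natr1; lra.
  have dmu1 : 1 <= mu * d%:R :> R by rewrite mulr_ege1.
  rewrite -natr1 natrM (natrM _ (m * n) N) (natrM _ 2) natrD -/mu.
  (* [4 d mu N + 1 <= 5 d mu N], and [N <= 4 t / delta] since [1 <= 2 t / delta] *)
  apply: (@le_trans _ _ (5 * (mu * d%:R * N%:R))).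
    have : 1 <= mu * d%:R * N%:R :> R by rewrite mulr_ege1.
    rewrite (_ : mu * N%:R * (2 * (d%:R + d%:R)) = 4 * (mu * d%:R * N%:R)); first by lra.
    by ring.
  apply: (@le_trans _ _ (5 * (mu * d%:R * (4 * t / delta)))).
    by rewrite ler_pM2l // ler_pM2l // (lt_le_trans _ dmu1).
  rewrite le_eqVlt; apply/orP; left; apply/eqP; rewrite /Q /delta; field.
  by rewrite !gt_eqF.
have Q0 : 0 < Q by rewrite !mulr_gt0 ?invr_gt0 ?ltr0n.
have [cov0|cov0] := leP (covering_number W eps) 0%E.
  by rewrite le0_lneNy // leNye.
apply: (@le_trans _ _ (lne (Q ^+ #|I|)%:E)).
  rewrite lee_lne ?in_itv /= ?leey ?(ltW cov0) ?lee_fin ?exprn_ge0 ?(ltW Q0) //.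
  by rewrite (le_trans covK) // lee_fin.
rewrite lne_EFin ?exprn_gt0 // lnXn // lee_fin -lnM ?posrE ?divr_gt0 ?mulr_gt0 ?ltr0n //.
by rewrite mulr_natl.
Qed.

End CoveringBound.

(** * Degrees of networks in their parameters *)

Section RatFracClosure.
Variables (R : realType) (I : finType) (T : Type) (X : T -> I -> R) (A : set T).

Lemma ratfrac_cst d c : ratfrac X A d (fun=> c).
Proof.
exists (fun=> c), (fun=> 1); split; try exact: polyfun_cst.
by move=> x _; rewrite oner_neq0 divr1.
Qed.

(** The common denominator is the product of the denominators of the [y e], so
    the number of terms enters the degree as a factor. *)
Lemma ratfrac_affine (E : finType) d (a : E -> T -> R) (b : T -> R) (y : E -> T -> R) :
  (forall e, polyfun X 1 (a e)) -> polyfun X 1 b ->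
  (forall e, ratfrac X A d (y e)) ->
  ratfrac X A (#|E| * d + 1) (fun x => \sum_e a e x * y e x + b x).
Proof.
move=> apoly bpoly /choice[p /choice[q pq]].
have ppoly e : polyfun X d (p e) by have [] := pq e.
have qpoly e : polyfun X d (q e) by have [] := pq e.
pose Q x := \prod_e q e x.
have Qpoly : polyfun X (#|E| * d) Q by exact: (polyfun_prod predT).
exists (fun x => \sum_e a e x * (p e x * \prod_(e' | e' != e) q e' x) + b x * Q x), Q.
split.
- apply: polyfunD; last by rewrite addnC; exact: polyfunM.
  apply: polyfun_sum => e.
  apply: (@polyfunW _ _ _ _ (1 + (d + #|predC1 e| * d))); last first.
    by apply: polyfunM => //; apply: polyfunM => //; exact: (polyfun_prod (predC1 e)).
  rewrite addnC leq_add2r -mulSn cardC1 prednK //.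
  by apply/card_gt0P; exists e.
- by apply: polyfunW Qpoly; rewrite leq_addr.
- move=> x Ax; have q0 e : q e x != 0 by have [_ _ /(_ x Ax)[]] := pq e.
  have Q0 : Q x != 0 by apply/prodf_neq0 => e _.
  split=> //; rewrite mulrDl mulfK //; congr (_ + _); rewrite mulr_suml.
  apply: eq_bigr => e _; rewrite -!mulrA; congr (_ * _).
  have [_ _ /(_ x Ax)[_ ->]] := pq e.
  have P0 : \prod_(e' | e' != e) q e' x != 0 by apply/prodf_neq0 => e' _.
  have -> : Q x = q e x * \prod_(e' | e' != e) q e' x by rewrite /Q (bigD1 e).
  by field; rewrite P0 q0.
Qed.

(** For [y = u / v], multiplying numerator and denominator of [rho(y)] by [v ^ s]
    turns both into forms of degree [s] in [u] and [v]; the coefficients of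
    [rho], being parameters themselves, account for the final [1]. *)
Lemma ratfrac_activation (s d : nat) (rho : T -> ratfun R) (y : T -> R) :
  (forall k, (k <= s)%N -> polyfun X 1 (fun x => (rho x).1`_k)) ->
  (forall k, (k <= s)%N -> polyfun X 1 (fun x => (rho x).2`_k)) ->
  (forall x, A x -> in_ratfun s s (rho x)) ->
  (forall x, A x -> (rho x).2.[y x] != 0) ->
  ratfrac X A d y ->
  ratfrac X A (s * d + 1) (fun x => ratfun_val (rho x) (y x)).
Proof.
move=> num den rhoS den0 [u [v [upoly vpoly uv]]].
pose hom (c : T -> nat -> R) x := \sum_(k < s.+1) c x k * (u x ^+ k * v x ^+ (s - k)).
have hom_poly c : (forall k, (k <= s)%N -> polyfun X 1 (c^~ k)) ->
    polyfun X (s * d + 1) (hom c).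
  move=> cpoly; apply: polyfun_sum => -[k /= ks].
  rewrite addnC -[X in (X * d)%N](subnKC (ltnSE ks)) mulnDl.
  by apply: polyfunM; [exact: cpoly | apply: polyfunM; exact: polyfunXn].
have homE (c : {poly R}) x : A x -> (size c <= s.+1)%N ->
    \sum_(k < s.+1) c`_k * (u x ^+ k * v x ^+ (s - k)) = v x ^+ s * c.[y x].
  move=> Ax cs; have [v0 ->] := uv x Ax.
  rewrite (horner_coef_wide _ cs) mulr_sumr; apply: eq_bigr => -[k /= ks] _.
  rewrite [RHS]mulrCA; congr (_ * _); rewrite exprMn -[in RHS](subnKC (ltnSE ks)) exprD exprVn.
  by field; rewrite expf_neq0.
exists (hom (fun x k => (rho x).1`_k)), (hom (fun x k => (rho x).2`_k)).
split; [exact: hom_poly|exact: hom_poly|] => x Ax; have [s1 s2 _] := rhoS x Ax.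
have [v0 _] := uv x Ax; have := den0 x Ax; rewrite /hom !homE // => d0.
split; first by rewrite mulf_neq0 ?expf_neq0.
by rewrite /ratfun_val; field; rewrite d0 expf_neq0.
Qed.

End RatFracClosure.

Section NetworkDegree.
Variables (R : realType) (d : nat -> nat).

(** The common form of full and convolutional layers.  A kernel entry is shared
    by all positions of the window, so [w] and [b] pick the parameters of one
    output among all parameters; constant terms come from the padding. *)
Definition affine_layers (T : Type) (I : finType) (X : T -> I -> R) (L : nat)
    (g : T -> forall l, 'cV[R]_(d l) -> 'cV[R]_(d l.+1)) (fanin : nat -> nat) :=
  forall l, (l < L)%N -> forall i, exists (E : finType) (w : E -> I) (b : I)
    (phi : E -> 'cV[R]_(d l) -> R),
    [/\ #|E| = fanin l,
        forall e, (exists j, phi e = fun z => z j 0) \/ (exists c, phi e = fun=> c)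
      & forall x z, g x l z i 0 = \sum_e X x (w e) * phi e z + X x b].

(** The recursion given by [ratfrac_affine] and [ratfrac_activation]; the data
    themselves have degree [0] in the parameters. *)
Fixpoint net_degree (s : nat) (fanin : nat -> nat) (l : nat) : nat :=
  if l is l'.+1 then s * (fanin l' * net_degree s fanin l' + 1) + 1 else 0.

(** Each layer contributes the additional summand [s + 1], at most
    [2 * s ^ L * \prod_(1 <= j < L) fanin j]; this is the origin of the factor
    [2 * L]. *)
Lemma net_degree_le s fanin L : (0 < s)%N ->
  (forall l, (l < L)%N -> (0 < fanin l)%N) ->
  (net_degree s fanin L <= 2 * L * (s ^ L * \prod_(1 <= j < L) fanin j))%N.
Proof.
move=> s0; elim: L => [//|L IHL] fan0 /=.
have {}IHL := IHL (fun l lL => fan0 l (ltnW lL)).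
have [->|L0] := posnP L; first by rewrite /= big_geq // muln0 expn1; lia.
rewrite big_nat_recr //=; set Q := (\prod_(1 <= i < L) _)%N in IHL *.
have Q0 : (0 < s ^ L.+1 * (Q * fanin L))%N.
  rewrite !muln_gt0 expn_gt0 s0 fan0 // andbT /= /Q big_nat.
  by apply: prodn_cond_gt0 => i /andP[_ iL]; rewrite fan0 // ltnW.
have sQ : (s <= s ^ L.+1 * (Q * fanin L))%N.
  rewrite expnS -mulnA leq_pmulr //; move: Q0; rewrite expnS -mulnA muln_gt0.
  by case/andP.
have : (s * (fanin L * net_degree s fanin L) <= 2 * L * (s ^ L.+1 * (Q * fanin L)))%N.
  rewrite (leq_trans (leq_mul (leqnn s) (leq_mul (leqnn (fanin L)) IHL))) //.
  by rewrite expnS; apply/eq_leq; ring.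
move: (s ^ L.+1 * _)%N Q0 sQ => Z; nia.
Qed.

Section Parametrized.
Variables (T : Type) (I : finType) (X : T -> I -> R) (A : set T) (L s : nat).
Variables (g : T -> forall l, 'cV[R]_(d l) -> 'cV[R]_(d l.+1)) (fanin : nat -> nat).
Variables (rho : T -> nat -> ratfun R).
Hypothesis g_affine : affine_layers X L g fanin.
Hypothesis num_poly : forall l k, (l < L)%N -> (k <= s)%N ->
  polyfun X 1 (fun x => (rho x l).1`_k).
Hypothesis den_poly : forall l k, (l < L)%N -> (k <= s)%N ->
  polyfun X 1 (fun x => (rho x l).2`_k).
Hypothesis rhoS : forall x l, A x -> (l < L)%N -> in_ratfun s s (rho x l).

Lemma ratfrac_network (v : 'cV[R]_(d 0)) :
  (forall x, A x -> network (g x) (rho x) L v) ->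
  forall i, ratfrac X A (net_degree s fanin L)
    (fun x => odflt 0 (network (g x) (rho x) L v) i 0).
Proof.
suff H l : (l <= L)%N -> (forall x, A x -> network (g x) (rho x) l v) ->
    forall i, ratfrac X A (net_degree s fanin l)
      (fun x => odflt 0 (network (g x) (rho x) l v) i 0) by exact: H.
elim: l => [|l IHl] lL def i; first exact: ratfrac_cst.
pose z x := odflt 0 (network (g x) (rho x) l v).
have step x : A x -> network (g x) (rho x) l v = Some (z x) /\
    activate (rho x l) (g x (z x)).
  by move=> /def /=; rewrite /z; case: network.
have zfrac j : ratfrac X A (net_degree s fanin l) (fun x => z x j 0).
  by apply: IHl => [|x /step[-> //]]; exact: ltnW.
have [E [w [b [phi [cardE phiP gE]]]]] := g_affine lL i.
have gfrac : ratfrac X A (fanin l * net_degree s fanin l + 1) (fun x => g x (z x) i 0).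
  under eq_fun do rewrite gE.
  rewrite -cardE; apply: (@ratfrac_affine _ _ _ _ _ E _ (fun e x => X x (w e))
    (fun x => X x b) (fun e x => phi e (z x))) => [e||e]; try exact: polyfun_var.
  by have [[j ->]|[c ->]] := phiP e; [exact: zfrac | exact: ratfrac_cst].
have [p [q [pd qd pq]]] : ratfrac X A (net_degree s fanin l.+1)
    (fun x => ratfun_val (rho x l) (g x (z x) i 0)).
  apply: ratfrac_activation gfrac => [k ks|k ks|x Ax|x Ax].
  - exact: num_poly.
  - exact: den_poly.
  - exact: rhoS.
  - by have [_] := step x Ax; rewrite /activate; case: ifP => // /forallP/(_ i).
exists p, q; split=> // x Ax; have [q0 <-] := pq x Ax; split=> //.
have [zE] := step x Ax; rewrite /= zE /= /activate; case: ifP => //= _ _.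
by rewrite mxE.
Qed.

End Parametrized.
End NetworkDegree.

(** * From degrees to covering numbers of hypothesis classes *)

Lemma network_bounded (R : realType) (d : nat -> nat)
    (g : forall l, 'cV[R]_(d l) -> 'cV[R]_(d l.+1)) (rho : nat -> ratfun R)
    (L : nat) (t : R) (v : 'cV[R]_(d 0)) (y : 'cV[R]_(d L)) :
  (0 < L)%N -> ratfun_im (rho L.-1) `<=` `[- t, t] ->
  network g rho L v = Some y -> forall i, `|y i 0| <= t.
Proof.
case: L y => // L y _ imt /=; case: network => //= z.
rewrite /activate; case: ifP => // /forallP dom [<-] i.
have : `[- t, t]%classic (ratfun_val (rho L) (g L z i 0)).
  by apply: imt; exists (g L z i 0) => //; exact: dom.
by rewrite /= in_itv /= mxE ler_norml.
Qed.

(** The maximum keeps the bound valid for negative [t], where only the matrices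
    with no entries satisfy the hypothesis; a positive lower bound for the
    diameter then forces [0 < t] and [0 < m * n]. *)
Lemma eucl_diam_le (R : realType) (m n : nat) (W : set 'M[R]_(m, n)) (t : R) :
  (forall B, W B -> forall i j, `|B i j| <= t) ->
  (eucl_diam W <= (Num.sqrt (m * n)%:R * Num.max 0 (2 * t))%:E)%E.
Proof.
move=> Wt; apply: ge_ereal_sup => _ [B WB [C WC <-]]; rewrite lee_fin.
apply: eucl_dist_le => [|i j]; first by rewrite le_max lexx.
rewrite le_max; apply/orP; right; rewrite mulr_natl mulr2n.
by rewrite (le_trans (ler_normB _ _)) // lerD // Wt.
Qed.

(** The two sides differ in the powers of [m] ([3/2] against [5/2]) and in the
    factors [N] and [N + 1] of the second logarithm; both are in favour of the
    right one as the arguments of the logarithms are at least [1]. *)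
Lemma log_covering_bound_ge (R : realType) (t eps P : R) (N m s L D : nat) :
  (0 < N)%N -> (0 < m)%N -> (0 < D)%N -> D%:R <= 2 * N%:R * (s%:R ^+ L * P) ->
  N%:R * (ln (t / eps) + ln (20 * D%:R * (m%:R * Num.sqrt m%:R))) <=
  log_covering_bound 40 t eps N m s L P.
Proof.
move=> N0 m0 D0 DP; rewrite /log_covering_bound mulrDr lerD2l.
set Q := 20 * _ * _; set Z := 40 * _ * _ * _ * _.
have m1 : 1 <= m%:R :> R by rewrite ler1n.
have sm1 : 1 <= Num.sqrt m%:R :> R by rewrite -[leLHS]sqrtr1 ler_wsqrtr.
have D1 : 1 <= D%:R :> R by rewrite ler1n.
have Q1 : 1 <= Q.
  rewrite /Q -[leLHS]mulr1; apply: ler_pM => //; last by rewrite mulr_ege1.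
  by lra.
have QZ : Q <= Z.
  have powE : m%:R `^ (5 / 2) = m%:R ^+ 2 * Num.sqrt m%:R :> R.
    rewrite (_ : 5 / 2 = 2%:R + 2^-1); last by field.
    rewrite powRD; last by rewrite gt_eqF ?implybT // (lt_le_trans _ m1).
    by rewrite powR_mulrn ?ler0n // powR12_sqrt.
  have -> : Z = 20 * (2 * N%:R * (s%:R ^+ L * P)) * (m%:R ^+ 2 * Num.sqrt m%:R).
    by rewrite /Z powE; ring.
  apply: ler_pM; rewrite ?mulr_ge0 ?ler0n //; first by rewrite ler_wpM2l.
  by rewrite ler_wpM2r // expr2 ler_peMl.
have lnQ0 : 0 <= ln Q by rewrite ln_ge0.
have lnQZ : ln Q <= ln Z by rewrite ler_ln ?posrE // (lt_le_trans ltr01) // (le_trans Q1).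
by rewrite ler_pM // ler_nat.
Qed.

Section ParametrizedClass.
Variables (R : realType) (d : nat -> nat).
Variables (T : Type) (I : finType) (X : T -> I -> R) (ok : set T) (L s n : nat).
Variables (g : T -> forall l, 'cV[R]_(d l) -> 'cV[R]_(d l.+1)) (fanin : nat -> nat).
Variables (rho : T -> nat -> ratfun R) (t : R).
Hypothesis g_affine : affine_layers X L g fanin.
Hypothesis num_poly : forall l k, (l < L)%N -> (k <= s)%N ->
  polyfun X 1 (fun x => (rho x l).1`_k).
Hypothesis den_poly : forall l k, (l < L)%N -> (k <= s)%N ->
  polyfun X 1 (fun x => (rho x l).2`_k).
Hypothesis rhoS : forall x l, ok x -> (l < L)%N -> in_ratfun s s (rho x l).
Hypothesis rho_im : forall x, ok x -> ratfun_im (rho x L.-1) `<=` `[- t, t].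
Hypotheses (L0 : (0 < L)%N) (s0 : (0 < s)%N) (LI : (L <= #|I|)%N).
Hypothesis fanin0 : forall l, (l < L)%N -> (0 < fanin l)%N.

Lemma covering_bound_of_parameters (F : hclass R (d 0) (d L))
    (V : 'M[R]_(d 0, n)) (eps : R) :
  F = [set f | exists2 x, ok x & f = network (g x) (rho x) L] ->
  0 < eps -> (eps%:E <= eucl_diam (class_eval F V))%E ->
  (sup_log_covering F n eps <=
    (log_covering_bound 40 t eps #|I| (n * d L) s L
      (\prod_(1 <= j < L) (fanin j)%:R))%:E)%E.
Proof.
move=> FE eps0 eps_diam.
have Ft (U : 'M[R]_(d 0, n)) B : class_eval F U B -> forall i j, `|B i j| <= t.
  rewrite FE => -[f [x okx ->] fB] i j.
  have := network_bounded L0 (rho_im okx) (fB j) i.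
  by rewrite mxE.
have := le_trans eps_diam (eucl_diam_le (Ft V)); rewrite lee_fin => epst.
have := lt_le_trans eps0 epst => prod0.
have mx0 : 0 < Num.max 0 (2 * t).
  by rewrite lt_neqAle le_max lexx andbT; apply: contraTneq prod0 => <-; rewrite mulr0 ltxx.
have t0 : 0 < 2 * t by move: mx0; rewrite lt_max ltxx.
move: epst; rewrite max_r ?(ltW t0) // => epst.
have m0 : (0 < d L * n)%N.
  by rewrite lt0n; apply: contraTneq prod0 => ->; rewrite sqrtr0 mul0r ltxx.
apply: ge_ereal_sup => _ [U _ <-].
pose net j x := network (g x) (rho x) L (col j U).
pose A := [set x | ok x /\ forall j, net j x].
pose Y x : 'M[R]_(d L, n) := \matrix_(i, j) odflt 0 (net j x) i 0.
apply: le_trans (@lne_covering_number_ratfrac _ _ _ _ _ X A Y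
  (net_degree s fanin L) t eps (class_eval F U) m0 _ _ _ _) _.
- by case: L L0 => //= l _; rewrite addn1.
- by rewrite eps0.
- move=> i j; under eq_fun do rewrite mxE.
  apply: (ratfrac_network g_affine num_poly den_poly) => [x l [okx _]|x [_ netx]].
    exact: rhoS.
  exact: netx.
- move=> B WB; split; last exact: Ft WB.
  move: WB; rewrite FE => -[f [x okx ->] fB]; exists x.
    by split=> // j; rewrite /net fB.
  by apply/matrixP => i j; rewrite mxE /net fB /= mxE.
rewrite lee_fin (mulnC n); apply: log_covering_bound_ge => //.
- exact: leq_trans LI.
- by case: L L0 => //= l _; rewrite addn1.
rewrite -natr_prod -natrX -natrM -!natrM ler_nat.
apply: leq_trans (net_degree_le s0 fanin0) _.
by rewrite leq_mul2r leq_mul2l LI !orbT.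
Qed.

End ParametrizedClass.

(** * Fixed and trainable activations *)

Section Activations.
Variables (R : realType) (d : nat -> nat).
Variables (W : Type) (I : finType) (X : W -> I -> R) (L s n : nat).
Variables (g : W -> forall l, 'cV[R]_(d l) -> 'cV[R]_(d l.+1)) (fanin : nat -> nat).
Hypothesis g_affine : affine_layers X L g fanin.
Hypotheses (L0 : (0 < L)%N) (s0 : (0 < s)%N) (LI : (L <= #|I|)%N).
Hypothesis fanin0 : forall l, (l < L)%N -> (0 < fanin l)%N.

Lemma covering_bound_fixed (rho : nat -> ratfun R) (t : R) (F : hclass R (d 0) (d L))
    (V : 'M[R]_(d 0, n)) (eps : R) :
  (forall l, (l < L)%N -> in_ratfun s s (rho l)) ->
  ratfun_im (rho L.-1) `<=` `[- t, t] ->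
  F = [set f | exists w, f = network (g w) rho L] ->
  0 < eps -> (eps%:E <= eucl_diam (class_eval F V))%E ->
  (sup_log_covering F n eps <=
    (log_covering_bound 40 t eps #|I| (n * d L) s L
      (\prod_(1 <= j < L) (fanin j)%:R))%:E)%E.
Proof.
move=> rhoS rho_im FE.
apply: (@covering_bound_of_parameters _ _ _ _ X setT _ s _ g fanin (fun=> rho)) => //.
- by move=> l k _ _; exact: polyfun_cst.
- by move=> l k _ _; exact: polyfun_cst.
- by move=> _ l _; exact: rhoS.
- by rewrite FE; apply/seteqP; split=> f /= [w]; [|move=> _]; exists w.
Qed.

(** The activations contribute the coefficients of numerator ([true]) and
    denominator ([false]) of each layer, that is, [act_nparams s L] parameters. *)
Definition trainable_coords (x : W * (nat -> ratfun R))
    (i : I + 'I_L * (bool * 'I_s.+1)) : R :=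
  match i with
  | inl i => X x.1 i
  | inr (l, (num, k)) => if num then (x.2 l).1`_k else (x.2 l).2`_k
  end.

Lemma covering_bound_trainable (t : R) (F : hclass R (d 0) (d L))
    (V : 'M[R]_(d 0, n)) (eps : R) :
  F = [set f | exists w rho, [/\ forall l, (l < L)%N -> in_ratfun s s (rho l),
        ratfun_im (rho L.-1) `<=` `[- t, t] & f = network (g w) rho L]] ->
  0 < eps -> (eps%:E <= eucl_diam (class_eval F V))%E ->
  (sup_log_covering F n eps <=
    (log_covering_bound 40 t eps (#|I| + act_nparams s L) (n * d L) s L
      (\prod_(1 <= j < L) (fanin j)%:R))%:E)%E.
Proof.
move=> FE.
have cardI : #|{: I + 'I_L * (bool * 'I_s.+1)}| = (#|I| + act_nparams s L)%N.
  by rewrite card_sum !card_prod card_bool !card_ord.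
pose ok := [set x : W * (nat -> ratfun R) |
  (forall l, (l < L)%N -> in_ratfun s s (x.2 l)) /\ ratfun_im (x.2 L.-1) `<=` `[- t, t]].
rewrite -cardI; apply: (@covering_bound_of_parameters _ _ _ _ trainable_coords ok _ s _
  (fun x => g x.1) fanin (fun x => x.2)) => //.
- move=> l lL i; have [E [w [b [phi [cardE phiP gE]]]]] := g_affine lL i.
  by exists E, (inl \o w), (inl b), phi; split=> // x z; rewrite gE.
- move=> l k lL ks.
  exact: (polyfun_var trainable_coords
    (inr (Ordinal lL, (true, Ordinal (ks : (k < s.+1)%N))))).
- move=> l k lL ks.
  exact: (polyfun_var trainable_coords
    (inr (Ordinal lL, (false, Ordinal (ks : (k < s.+1)%N))))).
- by move=> x l [rhoS _]; exact: rhoS.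
- by move=> x [].
- by rewrite cardI (leq_trans LI) // leq_addr.
- rewrite FE; apply/seteqP; split=> f /=.
    by move=> [w [rho [rhoS rho_im ->]]]; exists (w, rho).
  by move=> [[w rho] [rhoS rho_im] ->]; exists w, rho.
Qed.

End Activations.

(** * Fully connected layers *)

Section FullyConnected.
Variables (R : realType) (d : nat -> nat) (L : nat).

Definition fc_params : Type :=
  ((forall l, 'M[R]_(d l.+1, d l)) * (forall l, 'cV[R]_(d l.+1)))%type.

Definition fc_index : finType :=
  {l : 'I_L & ('I_(d l.+1) * 'I_(d l) + 'I_(d l.+1))%type}.

Definition fc_coords (w : fc_params) (i : fc_index) : R :=
  match tagged i with
  | inl (o, j) => w.1 (tag i) o j
  | inr o => w.2 (tag i) o 0
  end.

Lemma card_fc_index : #|fc_index| = fc_nparams d L.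
Proof.
rewrite card_tagged sumnE big_map big_enum; apply: eq_bigr => l _.
by rewrite card_sum card_prod !card_ord.
Qed.

Lemma fc_affine : affine_layers fc_coords L (fun w => fc_layer w.1 w.2) d.
Proof.
move=> l lL i; pose tag_l := @Tagged _ (Ordinal lL)
  (fun l : 'I_L => ('I_(d l.+1) * 'I_(d l) + 'I_(d l.+1))%type).
exists 'I_(d l), (fun j => tag_l (inl (i, j))), (tag_l (inr i)),
  (fun j (z : 'cV_(d l)) => z j 0).
split=> [|j|w z]; [exact: card_ord | by left; exists j |].
by rewrite /fc_layer !mxE.
Qed.

End FullyConnected.

(** * Convolutional layers *)

Section Convolutional.
Variables (R : realType) (a : cnn_arch R) (L : nat).

Definition cnn_params : Type :=
  ((forall l, 'M['M[R]_(ksize a)]_(channels a l.+1, channels a l)) *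
   (forall l, 'cV[R]_(cnn_dim a l.+1)))%type.

Definition cnn_index : finType :=
  {l : 'I_L & ('I_(channels a l.+1) * 'I_(channels a l) *
               ('I_(ksize a) * 'I_(ksize a)) + 'I_(cnn_dim a l.+1))%type}.

Definition cnn_coords (w : cnn_params) (i : cnn_index) : R :=
  match tagged i with
  | inl (o, c, (u, r)) => w.1 (tag i) o c u r
  | inr o => w.2 (tag i) o 0
  end.

Lemma card_cnn_index : #|cnn_index| = cnn_nparams a L.
Proof.
rewrite card_tagged sumnE big_map big_enum; apply: eq_bigr => l _.
by rewrite card_sum !card_prod !card_ord mulnn.
Qed.

Definition cnn_fanin l : nat := channels a l * (ksize a * ksize a).

(** An output pixel in channel [o] sees a [k * k] window in each input channel;
    window positions in the padding read the padding constant. *)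
Lemma cnn_affine :
  affine_layers cnn_coords L (fun w => conv_layer w.1 w.2) cnn_fanin.
Proof.
move=> l lL i; pose tag_l := @Tagged _ (Ordinal lL)
  (fun l : 'I_L => ('I_(channels a l.+1) * 'I_(channels a l) *
               ('I_(ksize a) * 'I_(ksize a)) + 'I_(cnn_dim a l.+1))%type).
case/mxvec_indexP: i => o yz; case/mxvec_indexP: yz => y z.
exists ('I_(channels a l) * ('I_(ksize a) * 'I_(ksize a)))%type,
  (fun e => tag_l (inl (o, e.1, e.2))), (tag_l (inr (mxvec_index o (mxvec_index y z)))),
  (fun (e : 'I_(channels a l) * ('I_(ksize a) * 'I_(ksize a)))
       (v : 'cV_(channels a l * (height a l * width a l))) =>
     padded_entry (vaxis a l) (haxis a l) (pad_value a l) v e.1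
       (y * stride (vaxis a l) + e.2.1) (z * stride (haxis a l) + e.2.2)).
split=> [|e|w v].
- by rewrite !card_prod !card_ord.
- rewrite /padded_entry; case: unpad => [y'|]; last by right; exists (pad_value a l).
  case: unpad => [z'|]; last by right; exists (pad_value a l).
  by left; exists (mxvec_index e.1 (mxvec_index y' z')).
rewrite /conv_layer mxE; congr (_ + _).
rewrite /convolve /col_of_image mxE mxvecE mxE mxvecE mxE.
under eq_bigr do rewrite pair_bigA /=.
by rewrite pair_bigA /=; apply: eq_bigr => -[c [u r]] _.
Qed.

End Convolutional.

Theorem theorem3p18 (R : realType) :
  exists c cT : R, [/\ 0 < c, 0 < cT,
    (* fully connected networks *)
    (forall (d : nat -> nat) (L s n : nat) (t : R),
      (0 < L)%N -> (0 < s)%N -> (forall l, (l <= L)%N -> (0 < d l)%N) ->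
      let P : R := \prod_(1 <= j < L) (d j)%:R in
      (forall rho : nat -> ratfun R,
        (forall l, (l < L)%N -> in_ratfun s s (rho l)) ->
        ratfun_im (rho L.-1) `<=` `[- t, t] ->
        let F := ratNN d rho L in
        let N := fc_nparams d L in
        forall (X : 'M[R]_(d 0%N, n)) (eps : R),
          0 < eps -> (eps%:E <= eucl_diam (class_eval F X))%E ->
          (sup_log_covering F n eps <=
            (log_covering_bound c t eps N (n * d L) s L P)%:E)%E) /\
      (let F := ratNN_trainable d s t L in
       let N := (fc_nparams d L + act_nparams s L)%N in
       forall (X : 'M[R]_(d 0%N, n)) (eps : R),
         0 < eps -> (eps%:E <= eucl_diam (class_eval F X))%E ->
         (sup_log_covering F n eps <=
           (log_covering_bound cT t eps N (n * d L) s L P)%:E)%E))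
  & (* convolutional networks *)
    (forall (a : cnn_arch R) (L s n : nat) (t : R),
      (0 < L)%N -> (0 < s)%N -> valid_cnn a L ->
      let P : R := (ksize a)%:R ^+ (2 * (L - 1)) *
                   \prod_(1 <= j < L) (channels a j)%:R in
      (forall rho : nat -> ratfun R,
        (forall l, (l < L)%N -> in_ratfun s s (rho l)) ->
        ratfun_im (rho L.-1) `<=` `[- t, t] ->
        let F := ratCNN a rho L in
        let N := cnn_nparams a L in
        forall (X : 'M[R]_(cnn_dim a 0, n)) (eps : R),
          0 < eps -> (eps%:E <= eucl_diam (class_eval F X))%E ->
          (sup_log_covering F n eps <=
            (log_covering_bound c t eps N (n * cnn_dim a L) s L P)%:E)%E) /\
      (let F := ratCNN_trainable a s t L in
       let N := (cnn_nparams a L + act_nparams s L)%N in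
       forall (X : 'M[R]_(cnn_dim a 0, n)) (eps : R),
         0 < eps -> (eps%:E <= eucl_diam (class_eval F X))%E ->
         (sup_log_covering F n eps <=
           (log_covering_bound cT t eps N (n * cnn_dim a L) s L P)%:E)%E))].

Proof.
exists 40, 40; split=> //.
- move=> d L s n t L0 s0 d0 /=.
  have LI : (L <= #|fc_index d L|)%N.
    rewrite card_fc_index -[leqLHS]card_ord -sum1_card; apply: leq_sum => l _.
    by rewrite addn_gt0 d0 ?orbT.
  have fanin0 l : (l < L)%N -> (0 < d l)%N by move=> /ltnW; exact: d0.
  rewrite -(card_fc_index d L); split=> [rho rhoS rho_im|] V eps.
    apply: (covering_bound_fixed (@fc_affine R d L) L0 s0 LI fanin0 rhoS rho_im).
    apply/seteqP; split=> f /= [].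
      by move=> A [b ->]; exists (A, b).
    by move=> [A b] ->; exists A, b.
  apply: (covering_bound_trainable (@fc_affine R d L) L0 s0 LI fanin0).
  apply/seteqP; split=> f /= [].
    by move=> A [b [rho]]; exists (A, b), rho.
  by move=> [A b] [rho]; exists A, b, rho.
- move=> a L s n t L0 s0 [k0 c0 _ _] /=.
  have -> : (ksize a)%:R ^+ (2 * (L - 1)) * \prod_(1 <= j < L) (channels a j)%:R =
      \prod_(1 <= j < L) (cnn_fanin a j)%:R :> R.
    rewrite /cnn_fanin; under [RHS]eq_bigr do rewrite natrM.
    by rewrite big_split /= prodr_const_nat natrM -expr2 -exprM mulrC.
  have LI : (L <= #|cnn_index a L|)%N.
    rewrite card_cnn_index -[leqLHS]card_ord -sum1_card; apply: leq_sum => l _.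
    by rewrite addn_gt0 /cnn_dim !muln_gt0 c0 ?orbT.
  have fanin0 l : (l < L)%N -> (0 < cnn_fanin a l)%N.
    by move=> /ltnW lL; rewrite /cnn_fanin !muln_gt0 c0 ?k0.
  rewrite -(card_cnn_index a L); split=> [rho rhoS rho_im|] V eps.
    apply: (covering_bound_fixed (@cnn_affine R a L) L0 s0 LI fanin0 rhoS rho_im).
    apply/seteqP; split=> f /= [].
      by move=> K [b ->]; exists (K, b).
    by move=> [K b] ->; exists K, b.
  apply: (covering_bound_trainable (@cnn_affine R a L) L0 s0 LI fanin0).
  apply/seteqP; split=> f /= [].
    by move=> K [b [rho]]; exists (K, b), rho.
  by move=> [K b] [rho]; exists K, b, rho.
Qed.
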